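(* Let $\mathbb{K}$ be a field, let $A_1,\ldots,A_m\in\mathbb{K}^{n\times n}$, and let $A=\sum_{k=1}^mA_kx_k$. Then $\operatorname{nc-Newton}A$ is an integral polytope (a polytope all of whose vertices are integer vectors) contained in $$\Bigl\{u\in\mathbb{R}^m\ \Big|\ u_i\ge0\ (i=1,2,\ldots,m),\ \sum_{i=1}^mu_i=n\Bigr\}.$$
   Context: For a positive integer $d$, the $d$-blow-up of $A$ is the $nd\times nd$ matrix $A^{\{d\}}=\sum_{k=1}^mA_k\otimes X_k$, where $\otimes$ is the Kronecker product and $X_k=(x_{k,ij})_{i,j\in[d]}$ is a $d\times d$ matrix of distinct commuting variables. $\operatorname{Newton}A^{\{d\}}\subseteq\mathbb{R}^{md^2}$ is the Newton polytope of the polynomial $\det A^{\{d\}}$ in the variables $x_{k,ij}$, i.e. the convex hull of the exponent vectors of its monomials with nonzero coefficient (empty if the determinant is zero). For $z=(z_{k,ij})_{k\in[m],i,j\in[d]}$, $\operatorname{proj}_d(z)\in\mathbb{R}^m$ is given by $\operatorname{proj}_d(z)_k=\frac1d\sum_{i,j\in[d]}z_{k,ij}$. The nc-Newton polytope of $A$ is $\operatorname{nc-Newton}A:=\bigcup_{d=1}^\infty\operatorname{proj}_d(\operatorname{Newton}A^{\{d\}})\subseteq\mathbb{R}^m$. The empty set is regarded as an (integral) polytope. *)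

(* Defs.v *)
From HB Require Import structures.
From mathcomp Require Export all_boot all_order all_algebra.
From mathcomp Require Export classical_sets reals.
From mathcomp Require Export mxtens.
From mathcomp.multinomials Require Export mpoly.

Set Implicit Arguments.
Unset Strict Implicit.
Unset Printing Implicit Defensive.

Import Order.TTheory GRing.Theory Num.Theory.

Local Open Scope classical_set_scope.
Local Open Scope ring_scope.

Definition conv (R : realType) (E : lmodType R) (S : set E) : set E :=
  [set x | exists (N : nat) (w : 'I_N -> R) (p : 'I_N -> E),
    [/\ forall i, 0 <= w i,
        \sum_(i < N) w i = 1,
        forall i, S (p i) &
        x = \sum_(i < N) w i *: p i]].

(* The empty set is a polytope: take [s := [::]]. *)
Definition is_polytope (R : realType) (N : nat) (P : set 'rV[R]_N) : Prop :=
  exists s : seq 'rV[R]_N, P = conv [set x | x \in s].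

Definition dotp (R : realType) (N : nat) (c x : 'rV[R]_N) : R :=
  \sum_(i < N) c 0 i * x 0 i.

Definition is_face (R : realType) (N : nat) (P F : set 'rV[R]_N) : Prop :=
  exists c : 'rV[R]_N,
    F = [set x | P x /\ forall y, P y -> dotp c y <= dotp c x].

Definition is_vertex (R : realType) (N : nat) (P : set 'rV[R]_N)
    (v : 'rV[R]_N) : Prop :=
  is_face P [set v].

Definition integral_polytope (R : realType) (N : nat) (P : set 'rV[R]_N) :
    Prop :=
  is_polytope P /\
  forall v, is_vertex P v -> forall i, v 0 i \is a Num.int.

Definition newton (R : realType) (K : fieldType) (N : nat)
    (p : {mpoly K[N]}) : set 'rV[R]_N :=
  conv [set x | exists2 e, e \in msupp p & x = \row_i (e i)%:R].

Arguments newton R {K N} p _.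

(* The m * d ^ 2 variables x_{k,ij} are numbered by [enum_rank] on the triples
   (k, i, j); coordinates of vectors in R^{m d^2} are numbered in the same way. *)
Definition nvars (m d : nat) : nat := #|{: 'I_m * 'I_d * 'I_d}|.

Definition vidx (m d : nat) (k : 'I_m) (i j : 'I_d) : 'I_(nvars m d) :=
  enum_rank (k, i, j).

Definition var_mx (K : fieldType) (m d : nat) (k : 'I_m) :
    'M[{mpoly K[nvars m d]}]_d :=
  \matrix_(i, j) 'X_(vidx k i j).

(* The linear matrix A = \sum_k A_k x_k is given by its coefficients A_k. *)
Definition blowup (K : fieldType) (m n : nat) (A : 'I_m -> 'M[K]_n) (d : nat) :
    'M[{mpoly K[nvars m d]}]_(n * d) :=
  \sum_(k < m) (map_mx (@mpolyC (nvars m d) K) (A k) *t var_mx K d k).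

Definition proj (R : realType) (m d : nat) (z : 'rV[R]_(nvars m d)) :
    'rV[R]_m :=
  \row_k (d%:R^-1 * \sum_(i < d) \sum_(j < d) z 0 (vidx k i j)).

Definition nc_newton (R : realType) (K : fieldType) (m n : nat)
    (A : 'I_m -> 'M[K]_n) : set 'rV[R]_m :=
  \bigcup_(d in [set d : nat | (0 < d)%N])
    (@proj R m d @` newton R (\det (blowup A d))).

Arguments nc_newton R {K m n} A _.

(* Main.v *)
(* For a natural weight c on the x_k, substitute x_{k,ij} by
   x_{k,ij} s^((j - i) mod d) t^(c_k). The matrices X_k then lie in a subring of
   d x d matrices over K[x_{k,ij}][s][t] that models a division algebra of degree
   d (a generic cyclic algebra): each nonzero element has a determinant whose
   t-degree is a multiple of d. Gaussian elimination by d x d blocks (the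
   Dieudonne determinant) transfers this to the whole blow-up, so the maximum of
   c over the exponents of det A^{d} is a multiple of d, and each
   proj_d(Newton A^{d}) is an integral polytope. These polytopes increase along
   divisibility of d and are hulls of subsets of one finite set of lattice
   points, so their union is one of them. *)
From HB Require Import structures.
From mathcomp Require Import fingroup perm boolp ring lra.
Require Import Defs.

Set Implicit Arguments.
Unset Strict Implicit.
Unset Printing Implicit Defensive.

Import Order.TTheory GRing.Theory Num.Theory.

Local Open Scope classical_set_scope.
Local Open Scope ring_scope.

(** * Elimination by blocks *)

Definition block_idx (n d : nat) (i : 'I_n) (a : 'I_d) : 'I_(n * d) :=
  mxtens_index (i, a).

Definition block (R : Type) (n d : nat) (i j : 'I_n) (M : 'M[R]_(n * d)) : 'M[R]_d :=
  mxsub (block_idx i) (block_idx j) M.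

Lemma block_idx0 (n d : nat) : @block_idx n.+1 d ord0 =1 lshift (n * d).
Proof. by move=> a; apply: val_inj. Qed.

Lemma block_idxS (n d : nat) (i : 'I_n) :
  block_idx (lift ord0 i) =1 @rshift d (n * d) \o block_idx i.
Proof. by move=> a; apply: val_inj; rewrite /= /bump /= add1n mulSn addnA. Qed.

(** Left multiplication by a block lower triangular matrix with blocks [1], [- c *m \adj a] and
    [\det a] clears [c] without dividing by [\det a]. This is the Schur complement formula with
    denominators removed. *)
Lemma det_schur_adj (R : comNzRingType) (p q : nat) (a : 'M[R]_p) (b : 'M[R]_(p, q))
    (c : 'M[R]_(q, p)) (e : 'M[R]_q) :
  (\det a) ^+ q * \det (block_mx a b c e) =
  \det a * \det (\det a *: e - c *m \adj a *m b).
Proof.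
have <- : \det (block_mx (1%:M : 'M_p) 0 (- (c *m \adj a)) (\det a)%:M)
   = (\det a) ^+ q.
  by rewrite det_lblock det1 mul1r det_scalar.
rewrite -det_mulmx mulmx_block !mul1mx !mul0mx !addr0 !mulNmx -(mulmxA _ _ a) mul_adj_mx.
by rewrite mul_mx_scalar mul_scalar_mx addNr det_ublock mul_scalar_mx addrC.
Qed.

Lemma det_add_block_row (R : comNzRingType) (p q : nat) (a : 'M[R]_p) (b : 'M[R]_(p, q))
    (c : 'M[R]_(q, p)) (e : 'M[R]_q) (Z : 'M[R]_(p, q)) :
  \det (block_mx (a + Z *m c) (b + Z *m e) c e) = \det (block_mx a b c e).
Proof.
have -> : block_mx (a + Z *m c) (b + Z *m e) c e =
    block_mx 1%:M Z 0 1%:M *m block_mx a b c e.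
  by rewrite mulmx_block !mul1mx !mul0mx !add0r.
by rewrite det_mulmx det_ublock !det1 !mul1r.
Qed.

Section BlockElimination.

Variables (R : idomainType) (d : nat) (S : 'M[{poly R}]_d -> Prop).
Hypothesis d_gt0 : (0 < d)%N.
Hypothesis S_add : forall a b, S a -> S b -> S (a + b).
Hypothesis S_sub : forall a b, S a -> S b -> S (a - b).
Hypothesis S_mul : forall a b, S a -> S b -> S (a *m b).
Hypothesis S_adj : forall a, S a -> a != 0 -> S (\adj a).
Hypothesis S_det : forall a, S a -> a != 0 -> \det a != 0 /\ (d %| (size (\det a)).-1)%N.

(** [S] stands for a division ring: a nonzero member is invertible up to its determinant. Induction
    on the number of blocks: the Schur complement [s] of a nonzero corner [a] again has blocks in
    [S], and [det_schur_adj] reads n d deg(det a) + deg(det M) = deg(det a) + deg(det s), where all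
    terms other than deg(det M) are multiples of [d]. *)
Lemma block_elimination (n : nat) (M : 'M[{poly R}]_(n * d)) :
  (forall i j, S (block i j M)) -> \det M != 0 -> (d %| (size (\det M)).-1)%N.
Proof.
have sizeM (x y : {poly R}) : x != 0 -> y != 0 ->
    (size (x * y)).-1 = ((size x).-1 + (size y).-1)%N.
  move=> x0 y0; rewrite size_mul //.
  move: x0 y0; rewrite -!size_poly_gt0.
  by case: (size x) => // sx _; case: (size y) => // sy _; rewrite addnS.
have sizeX (x : {poly R}) k : x != 0 -> (size (x ^+ k)).-1 = (k * (size x).-1)%N.
  by move=> x0; elim: k => [|k IHk]; rewrite ?expr0 ?size_poly1 // exprS sizeM ?expf_neq0 // IHk.
elim: n M => [|n IHn] M SM; first by rewrite det_mx00 size_poly1.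
move: (M : 'M_(d + n * d)) SM => {}M; rewrite -[M]submxK.
move: (ulsubmx M) (ursubmx M) (dlsubmx M) (drsubmx M) => a b c e SM.
have Sa : S a.
  suff -> : a = block ord0 ord0 (block_mx a b c e) by apply: SM.
  by apply/matrixP=> u v; rewrite mxE !block_idx0 block_mxEul.
have Sb j : S (colsub (block_idx j) b).
  suff -> : colsub (block_idx j) b = block ord0 (lift ord0 j) (block_mx a b c e) by apply: SM.
  by apply/matrixP=> u v; rewrite [LHS]mxE [RHS]mxE block_idx0 block_idxS block_mxEur.
have Sc i : S (rowsub (block_idx i) c).
  suff -> : rowsub (block_idx i) c = block (lift ord0 i) ord0 (block_mx a b c e) by apply: SM.
  by apply/matrixP=> u v; rewrite [LHS]mxE [RHS]mxE block_idx0 block_idxS block_mxEdl.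
have Se i j : S (block i j e).
  suff -> : block i j e = block (lift ord0 i) (lift ord0 j) (block_mx a b c e) by apply: SM.
  by apply/matrixP=> u v; rewrite [LHS]mxE [RHS]mxE !block_idxS block_mxEdr.
move=> {SM}.
(* If the corner vanishes, the first block column still has a nonzero block, since the determinant
   is nonzero. Adding the block row of that block to the first one makes the corner nonzero and
   keeps the determinant. *)
wlog a0 : a b Sa Sb / a != 0 => [wl|].
  have [a0|] := eqVneq a 0; last exact: wl.
  have [c0|c0] := eqVneq c 0.
    have -> : block_mx a b c e = block_mx 0 b 0 e :> 'M_(d + n * d) by rewrite a0 c0.
    by rewrite det_ublock -[X in \det X * _](scale0r 1%:M) detZ expr0n gtn_eqF // !mul0r eqxx.
  have [[i u] /= /existsP[v ci]] : exists iu : 'I_n * 'I_d,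
      [exists v, c (block_idx iu.1 iu.2) v != 0].
    case/matrix0Pn: c0 => k [v kv]; exists (mxtens_unindex k); apply/existsP; exists v.
    by rewrite /block_idx -surjective_pairing mxtens_unindexK.
  pose Z : 'M[{poly R}]_(d, n * d) := rowsub (block_idx i) 1%:M.
  have Zc : Z *m c = rowsub (block_idx i) c by rewrite mul_rowsub_mx mul1mx.
  have Ze : Z *m e = rowsub (block_idx i) e by rewrite mul_rowsub_mx mul1mx.
  rewrite -(det_add_block_row a b c e Z); apply: wl.
  - by rewrite Zc; apply: S_add.
  - move=> j; rewrite Ze raddfD /=; apply: S_add => //.
    by rewrite -mxsubcr; apply: Se.
  - by rewrite a0 add0r Zc; apply/matrix0Pn; exists u, v; rewrite mxE.
move=> D0.
have [da0 dda] := S_det Sa a0.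
have E := det_schur_adj a b c e.
set s := \det a *: e - _ in E.
have s0 : \det s != 0.
  apply: contra_neq (mulf_neq0 (expf_neq0 (n * d) da0) D0) => s0.
  by rewrite E s0 mulr0.
have : (d %| (size (\det s)).-1)%N.
  apply: IHn => // i j.
  (* The scalar matrix [\det a] is rewritten as [a *m \adj a], so that only products of members of
     [S] occur. *)
  have -> : block i j s =
      a *m \adj a *m block i j e - rowsub (block_idx i) c *m \adj a *m colsub (block_idx j) b.
    by rewrite /block raddfB /= linearZ /= mul_mx_adj mul_scalar_mx !mxsub_mul mxsub_id.
  by apply: S_sub; apply: S_mul => //; apply: S_mul => //; apply: S_adj.
move/(congr1 (fun x : {poly R} => (size x).-1)): E.
rewrite !sizeM ?expf_neq0 // sizeX // => E ds.
have : (d %| n * d * (size (\det a)).-1 + (size (\det (block_mx a b c e))).-1)%N.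
  by rewrite E dvdn_add.
by rewrite dvdn_addr // mulnAC dvdn_mull.
Qed.

End BlockElimination.

(** * Leading coefficients of determinants *)

Lemma coefM_top (R : nzRingType) (p q : {poly R}) (a b : nat) :
  (size p <= a.+1)%N -> (size q <= b.+1)%N -> (p * q)`_(a + b) = p`_a * q`_b.
Proof.
move=> sp sq; have lt_a : (a < (a + b).+1)%N by rewrite ltnS leq_addr.
rewrite coefM (bigD1 (Ordinal lt_a)) //= addKn big1 ?addr0 // => i ia.
have [lt_ia|le_ai] := ltnP i a.
  by rewrite [q`_ _]nth_default ?mulr0 // (leq_trans sq) // ltn_subRL -addSn leq_add2r.
rewrite [p`_ _]nth_default ?mul0r // (leq_trans sp) // ltn_neqAle le_ai andbT.
by apply: contra_neq ia => ai; apply: val_inj.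
Qed.

Lemma coef_prod_top (R : comNzRingType) (I : Type) (r : seq I) (F : I -> {poly R}) (N : nat) :
  (forall i, (size (F i) <= N.+1)%N) ->
  (size (\prod_(i <- r) F i)%R <= (size r * N).+1)%N /\
  (\prod_(i <- r) F i)`_(size r * N) = \prod_(i <- r) (F i)`_N.
Proof.
move=> sF; elim: r => [|i r [IHs IHc]]; first by rewrite !big_nil size_poly1 coef1.
rewrite !big_cons mulSn; split; last by rewrite coefM_top ?IHc.
apply: leq_trans (size_polyMleq _ _) _.
by rewrite -subn1 leq_subLR add1n -addnS -addSn leq_add.
Qed.

Lemma coef_det_top (R : comNzRingType) (d : nat) (M : 'M[{poly R}]_d) (N : nat) :
  (forall i j, (size (M i j) <= N.+1)%N) ->
  (size (\det M)%R <= (d * N).+1)%N /\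
  (\det M)`_(d * N) = \det (map_mx (coefp N) M).
Proof.
move=> sM; have sz : size (index_enum 'I_d) = d by rewrite -[index_enum _]enumT size_enum_ord.
have top (s : {perm _}) := coef_prod_top (index_enum 'I_d) (fun i => sM i (s i)).
split.
  apply: (leq_trans (size_sum _ _ _)); apply/bigmax_leqP => s _.
  by rewrite mulr_sign; case: (odd_perm s); rewrite ?size_polyN; have [] := top s; rewrite sz.
rewrite coef_sum; apply: eq_bigr => s _.
have [_] := top s; rewrite sz => cs.
have <- : \prod_i (M i (s i))`_N = \prod_i map_mx (coefp N) M i (s i).
  by apply: eq_bigr => i _; rewrite mxE.
by rewrite !mulr_sign; case: (odd_perm s); rewrite ?coefN cs.
Qed.

(** [N] is the largest degree of an entry. The coefficient of degree d N in [\det M] is the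
    determinant of the matrix of coefficients of degree [N], so the degree is exact unless that
    determinant vanishes. *)
Lemma lead_det (R : comNzRingType) (d : nat) (M : 'M[{poly R}]_d) : M != 0 ->
  exists N, map_mx (coefp N) M != 0 /\
    (\det (map_mx (coefp N) M) != 0 -> size (\det M) = (d * N).+1).
Proof.
move=> M0; have [i0 [j0 M00]] := matrix0Pn _ M0.
have [[i j] /= ijmax] : exists ij : 'I_d * 'I_d,
    forall i j, (size (M i j) <= size (M ij.1 ij.2))%N.
  case: (@arg_maxnP _ (i0, j0) xpredT (fun ij => size (M ij.1 ij.2))) => // ij _ H.
  by exists ij => i j; apply: (H (i, j)).
have Mij : M i j != 0.
  by rewrite -size_poly_gt0 (leq_trans _ (ijmax i0 j0)) // size_poly_gt0.
exists (size (M i j)).-1; split.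
  by apply/matrix0Pn; exists i, j; rewrite mxE /= -lead_coefE lead_coef_eq0.
move=> D0; have sM i' j' : (size (M i' j') <= (size (M i j)).-1.+1)%N.
  by rewrite prednK ?size_poly_gt0.
have [le_sz top] := coef_det_top sM.
apply/eqP; rewrite eqn_leq le_sz ltnNge; apply: contra D0 => /leq_sizeP/(_ _ (leqnn _)).
by rewrite top => ->.
Qed.

(** Rows and columns are permuted alike, so the two signs cancel. Two sizes are allowed because
    [n * (q * d)] and [q * (n * d)] are equal but not convertible. *)
Lemma det_reindex (R : comNzRingType) (n m : nat) (f : 'I_n -> 'I_m) (M : 'M[R]_m) :
  bijective f -> \det (mxsub f f M) = \det M.
Proof.
move=> bf; have enm : n = m by rewrite -(card_ord n) (bij_eq_card bf) card_ord.
case: m / enm f M bf => f M bf.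
have -> : mxsub f f M = row_perm (perm (bij_inj bf)) (col_perm (perm (bij_inj bf)) M).
  by apply/matrixP=> i j; rewrite !mxE !permE.
rewrite row_permE col_permE !det_mulmx !det_perm mulrCA.
by rewrite odd_permV -signr_addb addbb mulr1.
Qed.

Lemma det_monomial_neq0 (R : idomainType) (d : nat) (s : 'S_d) (M : 'M[R]_d) :
  (forall i j, M i j != 0 -> j = s i) -> (forall i, M i (s i) != 0) -> \det M != 0.
Proof.
move=> supp nz; have -> : M = diag_mx (\row_i M i (s i)) *m perm_mx s.
  apply/matrixP=> i j; rewrite mul_diag_mx !mxE.
  have [<-|ne] := eqVneq (s i) j; first by rewrite mulr1.
  rewrite mulr0; apply/eqP; apply: contraTT ne => Mij.
  by rewrite negbK; apply/eqP; rewrite -(supp _ _ Mij).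
rewrite det_mulmx det_perm det_diag mulf_neq0 ?signr_eq0 //.
by apply/prodf_neq0 => i _; rewrite mxE.
Qed.

(** * A generic cyclic algebra *)

(** The outer variable is t (exponent [u]), the inner one is s (exponent [k]). The s-exponents are
    congruent to b - a modulo [d]; moving [a] to the left avoids truncated subtraction. *)
Definition graded (E : nzRingType) (d a b : nat) (p : {poly {poly E}}) : Prop :=
  forall u k, p`_u`_k != 0 -> (k + a = b %[mod d])%N.

Section Graded.

Variables (E : comNzRingType) (d : nat).
Implicit Types p q : {poly {poly E}}.

Lemma graded0 a b : graded d a b (0 : {poly {poly E}}).
Proof. by move=> u k; rewrite !coef0 eqxx. Qed.

Lemma graded1 a : graded d a a (1 : {poly {poly E}}).
Proof.
move=> u k; rewrite coef1; case: (u == 0%N); rewrite ?coef0 ?eqxx // coef1.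
by case: (k =P 0%N) => [->//|_]; rewrite eqxx.
Qed.

Lemma gradedD a b p q : graded d a b p -> graded d a b q -> graded d a b (p + q).
Proof.
move=> gp gq u k; rewrite !coefD.
have [p0|pn0 _] := eqVneq p`_u`_k 0; last exact: gp pn0.
by rewrite p0 add0r; apply: gq.
Qed.

Lemma gradedN a b p : graded d a b p -> graded d a b (- p).
Proof. by move=> gp u k; rewrite !coefN oppr_eq0; apply: gp. Qed.

Lemma graded_sum a b (I : Type) (r : seq I) (P : pred I) (F : I -> {poly {poly E}}) :
  (forall i, P i -> graded d a b (F i)) -> graded d a b (\sum_(i <- r | P i) F i).
Proof.
move=> gF; elim/big_ind: _ => //; [exact: graded0 | exact: gradedD].
Qed.

Lemma gradedM a b a' b' p q :
  graded d a b p -> graded d a' b' q -> graded d (a + a') (b + b') (p * q).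
Proof.
have sum_n0 (I : finType) (F : I -> E) : \sum_i F i != 0 -> exists i, F i != 0.
  move=> F0; apply/existsP; apply: contraNT F0 => /existsPn F0.
  by apply/eqP/big1 => i _; apply/eqP; move: (F0 i); rewrite negbK.
move=> gp gq u k; rewrite coefM coef_sum => /sum_n0[v].
rewrite coefM => /sum_n0[l pq0].
have p0 : p`_v`_l != 0 by apply: contraNneq pq0 => ->; rewrite mul0r.
have q0 : q`_(u - v)`_(k - l) != 0 by apply: contraNneq pq0 => ->; rewrite mulr0.
have -> : (k + (a + a') = (l + a) + (k - l + a'))%N.
  by rewrite addnACA subnKC // -ltnS.
by rewrite -modnDm (gp _ _ p0) (gq _ _ q0) modnDm.
Qed.

Lemma graded_prod (I : Type) (r : seq I) (a b : I -> nat) (F : I -> {poly {poly E}}) :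
  (forall i, graded d (a i) (b i) (F i)) ->
  graded d (\sum_(i <- r) a i) (\sum_(i <- r) b i) (\prod_(i <- r) F i).
Proof.
move=> gF; elim: r => [|i r IHr]; first by rewrite !big_nil; apply: graded1.
by rewrite !big_cons; apply: gradedM.
Qed.

Lemma graded_det (n : nat) (a b : 'I_n -> nat) (M : 'M[{poly {poly E}}]_n) :
  (forall i j, graded d (a i) (b j) (M i j)) ->
  graded d (\sum_i a i) (\sum_i b i) (\det M).
Proof.
move=> gM; apply: graded_sum => s _; rewrite mulr_sign.
have g : graded d (\sum_i a i) (\sum_i b i) (\prod_i M i (s i)).
  by rewrite [X in graded _ _ X _](reindex_inj (@perm_inj _ s)) /=; apply: graded_prod.
by case: (odd_perm s) => //; apply: gradedN.
Qed.

(** The minor omits row [j] and column [i]. With T the sum of all indices, its s-exponents k satisfy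
    k + (T - j) = T - i modulo [d], that is k + i = j. *)
Lemma graded_adj (M : 'M[{poly {poly E}}]_d) :
  (forall i j : 'I_d, graded d i j (M i j)) -> forall i j : 'I_d, graded d i j ((\adj M) i j).
Proof.
move=> gM i j; rewrite mxE /cofactor -signr_odd mulr_sign.
have tot (l : 'I_d) : (\sum_(k < d) k = l + \sum_k lift l k)%N.
  by rewrite (bigD1_ord l).
have g : graded d i j (\det (row' j (col' i M))).
  have gdet : graded d (\sum_k lift j k) (\sum_k lift i k)
      (\det (row' j (col' i M))).
    by apply: graded_det => i' j'; rewrite !mxE.
  move=> u k /gdet Hk.
  apply/eqP; rewrite -(eqn_modDr (\sum_k lift j k)) -tot (tot i).
  by rewrite addnAC [(k + _ + i)%N]addnC eqn_modDl; apply/eqP.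
by case: (odd _) => //; apply: gradedN.
Qed.

End Graded.

Section CyclicAlgebra.

Variables (E : idomainType) (d : nat) (tau : {rmorphism E -> E}).
Hypothesis tau_inj : injective tau.

Local Notation tau2 := (map_poly (map_poly tau)).

(* With w = s^d, conjugating by diag(s^i) identifies these matrices with the
   cyclic algebra over E(t, w) generated by E and an element z such that
   z^d = w and z x = tau(x) z. *)
Definition cyclic_mx (M : 'M[{poly {poly E}}]_d) : Prop :=
  (forall i j, M (ordS i) (ordS j) = tau2 (M i j)) /\
  (forall i j : 'I_d, graded d i j (M i j)).

Lemma cyclic_mxD a b : cyclic_mx a -> cyclic_mx b -> cyclic_mx (a + b).
Proof.
move=> [sa ga] [sb gb]; split=> i j; rewrite !mxE; first by rewrite sa sb rmorphD.
exact: gradedD.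
Qed.

Lemma cyclic_mxN a : cyclic_mx a -> cyclic_mx (- a).
Proof.
move=> [sa ga]; split=> i j; rewrite !mxE; first by rewrite sa rmorphN.
exact: gradedN.
Qed.

Lemma cyclic_mxM a b : cyclic_mx a -> cyclic_mx b -> cyclic_mx (a *m b).
Proof.
move=> [sa ga] [sb gb]; split=> i j; rewrite !mxE.
  rewrite rmorph_sum (reindex_inj (@ordS_inj d)) /=; apply: eq_bigr => k _.
  by rewrite sa sb rmorphM.
apply: graded_sum => k _ u l H.
have := gradedM (ga i k) (gb k j) H.
by rewrite [(k + j)%N]addnC addnA => /eqP; rewrite eqn_modDr => /eqP.
Qed.

(** Take leading coefficients first in t (matrix [b]), then in s (matrix [c]). The grading confines
    [c] to the positions of one cyclic permutation, and shift equivariance with [tau] injective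
    spreads one nonzero entry along all of them. So [c] is monomial, [\det c] and then [\det b] are
    nonzero, and the t-degree of [\det a] is exactly d N. *)
Lemma cyclic_mx_det a : cyclic_mx a -> a != 0 ->
  \det a != 0 /\ (d %| (size (\det a)).-1)%N.
Proof.
move=> [sa ga] a0.
have [N [b0 da]] := lead_det a0; set b := map_mx _ a in b0 da.
have sb i j : b (ordS i) (ordS j) = map_poly tau (b i j).
  by rewrite !mxE /= sa coef_map.
have gb (i j : 'I_d) k : (b i j)`_k != 0 -> (k + i = j %[mod d])%N.
  by rewrite mxE; apply: ga.
have [r [c0 db]] := lead_det b0; set c := map_mx _ b in c0 db.
have sc i j : c (ordS i) (ordS j) = tau (c i j).
  by rewrite [LHS]mxE [c i j]mxE /= sb coef_map.
have gc (i j : 'I_d) : c i j != 0 -> (r + i = j %[mod d])%N.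
  by rewrite mxE /=; apply: gb.
have [i0 [j0 c00]] := matrix0Pn _ c0.
have d0 : (0 < d)%N by apply: leq_ltn_trans (ltn_ord i0).
pose f (i : 'I_d) := Ordinal (ltn_pmod (r + i) d0).
have f_inj : injective f.
  move=> i j /(congr1 val)/eqP /=; rewrite eqn_modDl !modn_small // => /eqP.
  exact: val_inj.
have fS i : f (ordS i) = ordS (f i).
  by apply: val_inj; rewrite /= modnDmr addnS -addn1 -[in RHS]addn1 modnDml.
have cf i j : c i j != 0 -> j = f i.
  by move/gc => ij; apply: val_inj; rewrite /= ij modn_small.
have nz i : c i (f i) != 0.
  have [k ->] : exists k, i = iter k (@ordS d) i0.
    (* Any index is reached from [i0] by iterating [ordS]; the summand [d - i0] cancels [i0] modulo
       [d]. *)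
    exists (i + (d - i0))%N; apply: val_inj.
    have -> k : val (iter k (@ordS d) i0) = ((k + i0) %% d)%N.
      elim: k => [|k IHk]; first by rewrite add0n modn_small.
      by rewrite iterS /= IHk -addn1 modnDml addn1.
    by rewrite -addnA subnK ?modnDr ?modn_small //; apply: ltnW.
  elim: k => [|k IHk]; first by rewrite /= -(cf _ _ c00).
  by rewrite iterS fS sc -(rmorph0 tau) (inj_eq tau_inj).
have dc : \det c != 0.
  apply: (det_monomial_neq0 (s := perm f_inj)) => [i j|i]; rewrite permE; [exact: cf|exact: nz].
have {}db : \det b != 0 by rewrite -size_poly_gt0 db.
have {}da := da db.
by rewrite -size_poly_gt0 da /= dvdn_mulr.
Qed.

(** Reindexing [\adj a] by [ordS] and applying [tau2] to it give two matrices with the same product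
    with [map_mx tau2 a], namely the scalar [\det a], which [tau2] fixes. Since [\det a] is nonzero,
    they coincide. *)
Lemma cyclic_mx_adj a : cyclic_mx a -> a != 0 -> cyclic_mx (\adj a).
Proof.
move=> ca a0; have [da _] := cyclic_mx_det ca a0; have [sa ga] := ca.
split; last exact: graded_adj.
pose c := @ordS d.
have cs : mxsub c c a = map_mx tau2 a by apply/matrixP=> i j; rewrite !mxE.
have tda : tau2 (\det a) = \det a.
  by rewrite -det_map_mx -cs det_reindex //; apply: ordS_bij.
suff eq_adj : mxsub c c (\adj a) = map_mx tau2 (\adj a).
  by move=> i j; move/matrixP/(_ i j): eq_adj; rewrite !mxE.
apply/eqP; rewrite -subr_eq0.
have : map_mx tau2 a *m (mxsub c c (\adj a) - map_mx tau2 (\adj a)) = 0.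
  rewrite mulmxBr -map_mxM mul_mx_adj map_scalar_mx /= tda -cs.
  have -> : mxsub c c a *m mxsub c c (\adj a) = mxsub c c (a *m \adj a).
    apply/matrixP=> i j; rewrite !mxE [RHS](reindex_inj (@ordS_inj d)) /=.
    by apply: eq_bigr => k _; rewrite !mxE.
  rewrite mul_mx_adj; apply/eqP; rewrite subr_eq0; apply/eqP/matrixP=> i j.
  by rewrite !mxE (inj_eq (@ordS_inj d)).
move/(congr1 (mulmx (\adj (map_mx tau2 a)))).
rewrite mulmx0 mulmxA mul_adj_mx mul_scalar_mx det_map_mx /= tda => /eqP.
by rewrite scalemx_eq0 (negPf da).
Qed.

Lemma det_cyclic_blocks (n : nat) (M : 'M[{poly {poly E}}]_(n * d)) :
  (0 < d)%N -> (forall i j, cyclic_mx (block i j M)) -> \det M != 0 ->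
  (d %| (size (\det M)).-1)%N.
Proof.
move=> d0; apply: block_elimination => //.
- exact: cyclic_mxD.
- by move=> a b ca cb; apply: cyclic_mxD => //; apply: cyclic_mxN.
- exact: cyclic_mxM.
- exact: cyclic_mx_adj.
- exact: cyclic_mx_det.
Qed.

End CyclicAlgebra.

(** * Weighted degrees of blow-up determinants *)

Definition weight (N : nat) (c : 'I_N -> nat) (e : 'X_{1..N}) : nat :=
  (\sum_(v < N) c v * e v)%N.

(** The support function of the Newton polytope in direction [c]; at the zero polynomial it takes
    the default value 0. *)
Definition wdeg (K : nzRingType) (N : nat) (c : 'I_N -> nat) (p : {mpoly K[N]}) : nat :=
  (\max_(e <- msupp p) weight c e)%N.

Lemma weight_le_wdeg (K : nzRingType) (N : nat) (c : 'I_N -> nat) (p : {mpoly K[N]}) e :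
  e \in msupp p -> (weight c e <= wdeg c p)%N.
Proof. by move=> ep; apply: (@leq_bigmax_seq _ _ xpredT). Qed.

Lemma wdeg_witness (K : nzRingType) (N : nat) (c : 'I_N -> nat) (p : {mpoly K[N]}) :
  p != 0 -> exists2 e, e \in msupp p & wdeg c p = weight c e.
Proof.
rewrite -msupp_eq0 /wdeg; elim: (msupp p) => // e s IHs _.
rewrite big_cons; case: s IHs => [_|e' s IHs].
  by exists e; rewrite ?mem_head // big_nil maxn0.
have [//|e1 e1s ->] := IHs _.
rewrite /maxn; case: ltnP => _; first by exists e1; rewrite // inE e1s orbT.
by exists e; rewrite ?mem_head.
Qed.

(** * Weights recorded as exponents of two extra variables *)

Section Twist.

Variables (K : comNzRingType) (N : nat) (E : idomainType).
Variables (iota : {rmorphism {mpoly K[N]} -> E}) (l c : 'I_N -> nat).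
Hypothesis iota_inj : injective iota.

Definition twist_const (a : K) : {poly {poly E}} := (iota a%:MP)%:P%:P.

Definition twist_var (v : 'I_N) : {poly {poly E}} :=
  ((iota 'X_v)%:P * 'X^(l v))%:P * 'X^(c v).

Lemma twist_const_is_zmod_morphism : zmod_morphism twist_const.
Proof. by move=> a b; rewrite /twist_const !rmorphB. Qed.

Lemma twist_const_is_monoid_morphism : monoid_morphism twist_const.
Proof. by split=> [|a b]; rewrite /twist_const ?rmorph1 ?rmorphM. Qed.

HB.instance Definition _ := GRing.isZmodMorphism.Build K {poly {poly E}} twist_const
  twist_const_is_zmod_morphism.
HB.instance Definition _ := GRing.isMonoidMorphism.Build K {poly {poly E}} twist_const
  twist_const_is_monoid_morphism.

(* x_v |-> x_v s^(l v) t^(c v), where t is the outer variable *)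
Definition twist : {rmorphism {mpoly K[N]} -> {poly {poly E}}} :=
  mmap twist_const twist_var.

Lemma twistE (p : {mpoly K[N]}) :
  twist p = \sum_(e <- msupp p)
    ((iota (p@_e *: 'X_[e]))%:P * 'X^(weight l e))%:P * 'X^(weight c e).
Proof.
rewrite /= /mmap; apply: eq_bigr => e _.
have -> : mmap1 twist_var e = ((iota 'X_[e])%:P * 'X^(weight l e))%:P * 'X^(weight c e).
  rewrite /mmap1 /weight -!prodrXr mpolyXE_id rmorph_prod rmorph_prod -big_split rmorph_prod.
  rewrite -big_split; apply: eq_bigr => v _ /=.
  by rewrite /twist_var exprMn -exprM -polyC_exp exprMn -exprM -polyC_exp -rmorphXn.
by rewrite /twist_const mulrA -polyCM mulrA -polyCM -rmorphM /= mul_mpolyC.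
Qed.

Lemma twistZX (a : K) (v : 'I_N) :
  twist (a *: 'X_v) = ((iota (a *: 'X_v))%:P * 'X^(l v))%:P * 'X^(c v).
Proof.
by rewrite /= mmapZ mmapX mmap1U /twist_const mulrA -polyCM mulrA -polyCM -rmorphM /= mul_mpolyC.
Qed.

(** Setting s = 1 in the coefficient of the top power of t gives the image under [iota] of the part
    of [p] of maximal weight. Different monomials of that part stay independent, so nothing
    cancels. *)
Lemma size_twist (p : {mpoly K[N]}) : p != 0 -> size (twist p) = (wdeg c p).+1.
Proof.
move=> p0; apply/eqP; rewrite eqn_leq; apply/andP; split.
  rewrite twistE (leq_trans (size_sum _ _ _)) //; apply/bigmax_leqP_seq => e ep _.
  apply: leq_trans (size_polyMleq _ _) _; rewrite size_polyXn addnS /= -addn1 addnC.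
  by rewrite leq_add ?size_polyC_leq1 //; apply: weight_le_wdeg.
have [e0 e0p we0] := wdeg_witness c p0.
rewrite ltnNge; apply/negP => /leq_sizeP/(_ _ (leqnn _)) tw0.
have : (\sum_(e <- msupp p | wdeg c p == weight c e) p@_e *: 'X_[e])@_e0 = 0.
  suff -> : \sum_(e <- msupp p | wdeg c p == weight c e) p@_e *: 'X_[e] = 0 by rewrite mcoeff0.
  apply: iota_inj; rewrite rmorph0 rmorph_sum /=.
  have : ((twist p)`_(wdeg c p)).[1] = 0 by rewrite tw0 horner0.
  rewrite twistE coef_sum horner_sum => tw1; rewrite -[RHS]tw1 big_mkcond /=.
  apply: eq_bigr => e _; rewrite coefCM coefXn.
  by case: eqP => _; rewrite ?mulr0 ?horner0 // mulr1 !hornerE expr1n mulr1.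
rewrite raddf_sum /= big_mkcond (bigD1_seq e0) ?msupp_uniq //= -we0 eqxx.
rewrite mcoeffZ mcoeffX eqxx mulr1 big1 ?addr0 => [/eqP|e ne].
  by rewrite -[_ == 0]negbK -mcoeff_msupp e0p.
by case: ifP => // _; rewrite mcoeffZ mcoeffX (negPf ne) mulr0.
Qed.

Lemma wdegX_twist (p : {mpoly K[N]}) (q : nat) :
  p != 0 -> p ^+ q != 0 -> wdeg c (p ^+ q) = (wdeg c p * q)%N.
Proof.
move=> p0 pq0; have := size_exp (twist p) q.
by rewrite -rmorphXn size_twist // size_twist.
Qed.

End Twist.

(** The twist with all s-exponents zero turns the weighted degree into a t-degree over a domain,
    which is multiplicative on powers. *)
Lemma wdegX (K : fieldType) (N : nat) (c : 'I_N -> nat) (p : {mpoly K[N]}) (q : nat) :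
  p != 0 -> wdeg c (p ^+ q) = (wdeg c p * q)%N.
Proof.
move=> p0; apply: (@wdegX_twist K N {mpoly K[N]} idfun (fun=> 0%N)) => //.
exact: expf_neq0.
Qed.

Section VarIndex.

Variables (m d : nat).

Definition var_mat (v : 'I_(nvars m d)) : 'I_m := (enum_val v).1.1.
Definition var_row (v : 'I_(nvars m d)) : 'I_d := (enum_val v).1.2.
Definition var_col (v : 'I_(nvars m d)) : 'I_d := (enum_val v).2.

Lemma vidxK v : vidx (var_mat v) (var_row v) (var_col v) = v.
Proof.
by rewrite /vidx /var_mat /var_row /var_col -!surjective_pairing enum_valK.
Qed.

Lemma var_mat_vidx k i j : var_mat (vidx k i j) = k.
Proof. by rewrite /var_mat /vidx enum_rankK. Qed.

Lemma var_row_vidx k i j : var_row (vidx k i j) = i.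
Proof. by rewrite /var_row /vidx enum_rankK. Qed.

Lemma var_col_vidx k i j : var_col (vidx k i j) = j.
Proof. by rewrite /var_col /vidx enum_rankK. Qed.

(** Renaming the variables along this shift is the automorphism [tau] of the cyclic algebra. *)
Definition var_shift (v : 'I_(nvars m d)) : 'I_(nvars m d) :=
  vidx (var_mat v) (ordS (var_row v)) (ordS (var_col v)).

Lemma var_shift_inj : injective var_shift.
Proof.
move=> v w vw; rewrite -[v]vidxK -[w]vidxK.
have := congr1 var_mat vw; rewrite !var_mat_vidx => ->.
have := congr1 var_row vw; rewrite !var_row_vidx => /ordS_inj ->.
by have := congr1 var_col vw; rewrite !var_col_vidx => /ordS_inj ->.
Qed.

(** The residue of column minus row modulo [d]; the row is subtracted from [d], so the subtraction
    does not truncate. *)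
Definition var_offset (v : 'I_(nvars m d)) : nat :=
  ((var_col v + (d - var_row v)) %% d)%N.

Lemma var_offset_shift v : var_offset (var_shift v) = var_offset v.
Proof.
rewrite /var_offset /var_shift var_row_vidx var_col_vidx /=.
set i := var_row v; set j := var_col v.
have d0 : (0 < d)%N by apply: leq_ltn_trans (ltn_ord i).
apply/eqP; rewrite -(eqn_modDr (i.+1 %% d)) -addnA subnK; last exact/ltnW/ltn_pmod.
rewrite modnDr modn_mod modnDmr -addnA addnS subnK; last exact: ltnW.
by rewrite addnS -addSn modnDr.
Qed.

End VarIndex.

Lemma blowupE (K : fieldType) (m n d : nat) (A : 'I_m -> 'M[K]_n) (i j : 'I_n) (a b : 'I_d) :
  blowup A d (block_idx i a) (block_idx j b) = \sum_(k < m) A k i j *: 'X_(vidx k a b).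
Proof.
rewrite /blowup summxE; apply: eq_bigr => k _.
by rewrite tensmxE !mxE mul_mpolyC.
Qed.

Lemma var_offsetP (m d : nat) (k : 'I_m) (a b : 'I_d) :
  (var_offset (vidx k a b) + a = b %[mod d])%N.
Proof.
rewrite /var_offset var_row_vidx var_col_vidx modnDml -addnA subnK ?modnDr //.
exact: ltnW.
Qed.

Lemma map_poly2_monomial (E : idomainType) (tau : {rmorphism E -> E}) (x : E) (u w : nat) :
  map_poly (map_poly tau) ((x%:P * 'X^u)%:P * 'X^w) = ((tau x)%:P * 'X^u)%:P * 'X^w.
Proof.
apply/polyP=> i; rewrite coef_map /= !coefCM !coefXn.
case: (i == w); last by rewrite !mulr0 rmorph0.
rewrite !mulr1; apply/polyP=> j; rewrite coef_map /= !coefCM !coefXn.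
by case: (j == u); rewrite ?mulr1 // !mulr0 rmorph0.
Qed.

Section BlowupTwist.

Variables (K : fieldType) (m n d : nat) (E : idomainType).
Variables (iota : {rmorphism {mpoly K[nvars m d]} -> E}) (tau : {rmorphism E -> E}).
Hypothesis iota_inj : injective iota.
Hypothesis tau_inj : injective tau.
Hypothesis tau_shift : forall (a : K) (v : 'I_(nvars m d)),
  tau (iota (a *: 'X_v)) = iota (a *: 'X_(var_shift v)).

(** Each block of the twisted blow-up is a [cyclic_mx]: entry (a, b) has s-exponent b - a modulo
    [d], and shifting both indices renames the variables by [tau] while keeping the exponents of s
    and t. By [size_twist] the t-degree of the determinant is the weighted degree. *)
Lemma dvdn_wdeg_twist (A : 'I_m -> 'M[K]_n) (c : 'I_m -> nat) :
  (0 < d)%N -> \det (blowup A d) != 0 ->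
  (d %| wdeg (c \o @var_mat m d) (\det (blowup A d)))%N.
Proof.
move=> d0 D0; set C := c \o _; pose tw := twist iota (@var_offset m d) C.
have sz : size (tw (\det (blowup A d))) = (wdeg C (\det (blowup A d))).+1.
  exact: size_twist.
have dE : \det (map_mx tw (blowup A d)) = tw (\det (blowup A d)) by apply: det_map_mx.
have : (d %| (size (\det (map_mx tw (blowup A d)))).-1)%N; last by rewrite dE sz.
apply: (det_cyclic_blocks tau_inj) => //; last first.
  by rewrite dE -size_poly_gt0 sz.
move=> i j; pose B := block i j (map_mx tw (blowup A d)).
have entry a b : B a b = \sum_(k < m)
    ((iota (A k i j *: 'X_(vidx k a b)))%:P * 'X^(var_offset (vidx k a b)))%:P * 'X^(c k).
  rewrite /B 2!mxE blowupE rmorph_sum; apply: eq_bigr => k _.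
  by rewrite twistZX /C /= var_mat_vidx.
rewrite -/B; split=> a b; rewrite !entry.
  rewrite rmorph_sum; apply: eq_bigr => k _.
  rewrite [RHS]map_poly2_monomial tau_shift.
  have -> : vidx k (ordS a) (ordS b) = var_shift (vidx k a b).
    by rewrite /var_shift var_mat_vidx var_row_vidx var_col_vidx.
  by rewrite var_offset_shift.
apply: graded_sum => k _ u r; rewrite coefCM coefXn.
case: (u == _); rewrite ?mulr0 ?coef0 ?eqxx // mulr1 coefCM coefXn.
by case: (r =P _) => [->|_]; rewrite ?mulr0 ?eqxx // => _; apply: var_offsetP.
Qed.

End BlowupTwist.

Lemma dvdn_wdeg_det_blowup (K : fieldType) (m n d : nat) (A : 'I_m -> 'M[K]_n)
    (c : 'I_m -> nat) :
  (0 < d)%N -> \det (blowup A d) != 0 ->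
  (d %| wdeg (c \o @var_mat m d) (\det (blowup A d)))%N.
Proof.
pose sigma := perm (@var_shift_inj m d).
apply: (@dvdn_wdeg_twist K m n d {mpoly K[nvars m d]} idfun (msym sigma)) => //.
  exact: inj_msym.
move=> a v /=; rewrite msymZ msymX; congr (_ *: 'X_[_]).
apply/mnmP=> w; rewrite mnmE !mnm1E -[in RHS](permKV sigma w).
by rewrite [in RHS]permE (inj_eq (@var_shift_inj _ _)).
Qed.

(** * Comparison of the blow-ups of sizes d and q d *)

Lemma det_tens1mx (R : comNzRingType) (q N : nat) (M : 'M[R]_N) :
  \det ((1%:M : 'M_q) *t M) = (\det M) ^+ q.
Proof.
elim: q => [|q IHq]; first by rewrite det_mx00.
have -> : (1%:M : 'M_q.+1) *t M = block_mx M 0 0 ((1%:M : 'M_q) *t M) :> 'M_(N + q * N).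
  apply/matrixP=> u v; case: (mxtens_indexP (u : 'I_(q.+1 * N))) => i a.
  case: (mxtens_indexP (v : 'I_(q.+1 * N))) => j b.
  apply: (etrans (tensmxE _ _ _ _ _ _)); rewrite -/(block_idx i a) -/(block_idx j b).
  case: (unliftP ord0 i) => [i'|] ->; case: (unliftP ord0 j) => [j'|] ->;
    rewrite ?block_idx0 ?block_idxS /= ?block_mxEul ?block_mxEur ?block_mxEdl ?block_mxEdr
      ?tensmxE !mxE ?mul0r ?mul1r //.
by rewrite det_ublock IHq exprS.
Qed.

Lemma mmap1_monomial (K : comNzRingType) (N N' : nat) (c : 'I_N -> nat) (c' : 'I_N' -> nat)
    (g : 'I_N -> {mpoly K[N']}) (e : 'X_{1..N}) :
  (forall v, g v = 0 \/ exists2 w, g v = 'X_w & c' w = c v) ->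
  mmap1 g e = 0 \/ exists2 f, mmap1 g e = 'X_[f] & weight c' f = weight c e.
Proof.
move=> gP; rewrite /mmap1 /weight; elim: (index_enum _) => [|v r IHr].
  right; exists 0%MM; first by rewrite big_nil mpolyX0.
  by rewrite big_nil /weight big1 // => w _; rewrite mnm0E muln0.
(* Exponent zero is treated apart because 0 ^ 0 = 1: a variable sent to 0 kills only the monomials
   in which it occurs. *)
rewrite !big_cons; have [->|ev0] := eqVneq (e v) 0%N.
  by rewrite expr0 mul1r muln0 add0n.
have [->|[w -> cw]] := gP v; first by left; rewrite expr0n (negPf ev0) mul0r.
have [->|[f -> wf]] := IHr; first by left; rewrite mulr0.
right; exists (U_(w) *+ e v + f)%MM; first by rewrite mpolyXn mpolyXD.
rewrite -wf -cw /weight (eq_bigr (fun u => c' u * (w == u) * e v + c' u * f u)%N).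
  rewrite big_split; congr (_ + _)%N; rewrite /= (bigD1 w) //= eqxx muln1 big1 ?addn0 // => u uw.
  by rewrite eq_sym (negPf uw) muln0.
by move=> u _; rewrite mnmDE mulmnE mnm1E mulnDr mulnA.
Qed.

(** Each term is killed or keeps its weight, and cancellation can only remove terms. *)
Lemma wdeg_mmap_le (K : comNzRingType) (N N' : nat) (c : 'I_N -> nat) (c' : 'I_N' -> nat)
    (g : 'I_N -> {mpoly K[N']}) (p : {mpoly K[N]}) :
  (forall v, g v = 0 \/ exists2 w, g v = 'X_w & c' w = c v) ->
  (wdeg c' (mmap (@mpolyC N' K) g p) <= wdeg c p)%N.
Proof.
move=> gP; apply/bigmax_leqP_seq => f; rewrite mcoeff_msupp => f0 _.
have /hasP[e ep] : has (fun e => (mmap1 g e)@_f != 0) (msupp p).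
  apply: contraNT f0 => /hasPn H; rewrite /mmap raddf_sum /= big1_seq // => e /= /H.
  by rewrite negbK mcoeffCM => /eqP ->; rewrite mulr0.
have [->|[f' -> we]] := mmap1_monomial e gP; first by rewrite mcoeff0 eqxx.
rewrite mcoeffX; have [<- _|_] := eqVneq f' f; last by rewrite eqxx.
by rewrite we weight_le_wdeg.
Qed.

(** Specialise each generic matrix of size q d to a block diagonal one with [q] copies of the
    generic matrix of size [d]. Up to reordering, the blow-up becomes [q] diagonal copies of the
    smaller one, with determinant the [q]-th power. The specialisation does not raise the weighted
    degree. *)
Lemma wdeg_det_blowupM (K : fieldType) (m n d q : nat) (A : 'I_m -> 'M[K]_n)
    (c : 'I_m -> nat) :
  \det (blowup A d) != 0 ->
  \det (blowup A (q * d)) != 0 /\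
  (wdeg (c \o @var_mat m d) (\det (blowup A d)) * q <=
   wdeg (c \o @var_mat m (q * d)) (\det (blowup A (q * d))))%N.
Proof.
move=> D0.
pose g (v : 'I_(nvars m (q * d))) : {mpoly K[nvars m d]} :=
  let: (a, i) := mxtens_unindex (var_row v) in
  let: (b, j) := mxtens_unindex (var_col v) in
  if a == b then 'X_(vidx (var_mat v) i j) else 0.
pose psi := mmap (@mpolyC (nvars m d) K) g.
(* [f] moves the Kronecker factor of size [q] to the front. *)
pose f (u : 'I_(n * (q * d))) : 'I_(q * (n * d)) :=
  let: (i, ab) := mxtens_unindex u in let: (a, b) := mxtens_unindex ab in
  mxtens_index (a, mxtens_index (i, b)).
pose f' (u : 'I_(q * (n * d))) : 'I_(n * (q * d)) :=
  let: (a, ib) := mxtens_unindex u in let: (i, b) := mxtens_unindex ib in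
  mxtens_index (i, mxtens_index (a, b)).
have fE i a b : f (mxtens_index (i, mxtens_index (a, b))) = mxtens_index (a, mxtens_index (i, b)).
  by rewrite /f !mxtens_indexK.
have f_bij : bijective f.
  exists f' => u; case: (mxtens_indexP u) => i v; case: (mxtens_indexP v) => a b;
    by rewrite /f /f' !mxtens_indexK.
have psiD : psi (\det (blowup A (q * d))) = (\det (blowup A d)) ^+ q.
  rewrite /psi -det_map_mx -/psi -det_tens1mx -(det_reindex _ f_bij); congr (\det _).
  apply/matrixP=> u v; case: (mxtens_indexP u) => i u'; case: (mxtens_indexP u') => a r.
  case: (mxtens_indexP v) => j v'; case: (mxtens_indexP v') => b s.
  rewrite [LHS]mxE [RHS]mxE !fE tensmxE.
  rewrite -/(block_idx i _) -/(block_idx j _) blowupE rmorph_sum /=.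
  rewrite -/(block_idx i r) -/(block_idx j s) blowupE mxE mulr_sumr; apply: eq_bigr => k _.
  rewrite mmapZ mmapX mmap1U /g var_row_vidx var_col_vidx var_mat_vidx !mxtens_indexK.
  by case: (a == b); rewrite ?mulr1n ?mulr0n ?mulr0 ?mul0r // mul1r mul_mpolyC.
have psiD0 : psi (\det (blowup A (q * d))) != 0 by rewrite psiD expf_neq0.
split; first by apply: contraNneq psiD0 => ->; rewrite /psi raddf0.
rewrite -wdegX // -psiD; apply: wdeg_mmap_le => // v; rewrite /g.
case: mxtens_unindex => a i; case: mxtens_unindex => b j.
case: (a == b); last by left.
by right; eexists; rewrite //= var_mat_vidx.
Qed.

(** * Convexity and separation *)

Section Dotp.

Variables (R : realType) (N : nat).
Implicit Types c x y : 'rV[R]_N.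

Lemma dotpDr c x y : dotp c (x + y) = dotp c x + dotp c y.
Proof. by rewrite /dotp -big_split; apply: eq_bigr => i _; rewrite mxE mulrDr. Qed.

Lemma dotpZr c a x : dotp c (a *: x) = a * dotp c x.
Proof. by rewrite /dotp mulr_sumr; apply: eq_bigr => i _; rewrite mxE mulrCA. Qed.

Lemma dotpC c x : dotp c x = dotp x c.
Proof. by apply: eq_bigr => i _; rewrite mulrC. Qed.

Lemma dotpZl c a x : dotp (a *: x) c = a * dotp x c.
Proof. by rewrite ![dotp _ c]dotpC dotpZr. Qed.

Lemma dotpBr c x y : dotp c (x - y) = dotp c x - dotp c y.
Proof. by rewrite -scaleN1r dotpDr dotpZr mulN1r. Qed.

Lemma dotpBl c x y : dotp (x - y) c = dotp x c - dotp y c.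
Proof. by rewrite ![dotp _ c]dotpC dotpBr. Qed.

Lemma dotp_sumr c (I : Type) (r : seq I) (F : I -> 'rV[R]_N) :
  dotp c (\sum_(i <- r) F i) = \sum_(i <- r) dotp c (F i).
Proof.
elim: r => [|i r IHr]; last by rewrite !big_cons dotpDr IHr.
by rewrite !big_nil -(scale0r 0) dotpZr mul0r.
Qed.

Lemma dotp_le_conv c b (A : set 'rV[R]_N) x :
  (forall u, A u -> dotp c u <= b) -> conv A x -> dotp c x <= b.
Proof.
move=> Ab [M [w [p [w0 w1 pA ->]]]].
rewrite dotp_sumr -[b]mul1r -w1 mulr_suml; apply: ler_sum => i _.
by rewrite dotpZr ler_wpM2l // Ab.
Qed.

End Dotp.

Section Conv.

Variables (R : realType) (E : lmodType R).

Lemma sub_conv (A : set E) : A `<=` conv A.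
Proof.
move=> x Ax; exists 1%N, (fun _ => 1), (fun _ => x).
by split=> //; rewrite big_ord1 ?scale1r.
Qed.

Lemma conv_sub (A B : set E) : A `<=` B -> conv A `<=` conv B.
Proof.
by move=> AB x [M [w [p [w0 w1 pA ->]]]]; exists M, w, p; split=> // i; apply/AB/pA.
Qed.

(** The weights of all points with the same [index] in [s] are added up. *)
Lemma conv_seqP (s : seq E) (x : E) : conv [set y | y \in s] x ->
  exists w : 'I_(size s) -> R,
    [/\ forall i, 0 <= w i, \sum_i w i = 1 & x = \sum_i w i *: s`_i].
Proof.
move=> [M [w [p [w0 w1 ps ->]]]].
have lt_idx i : (index (p i) s < size s)%N by rewrite index_mem; apply: ps.
pose f i := Ordinal (lt_idx i).
exists (fun j => \sum_(i | f i == j) w i); split.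
- by move=> j; apply: sumr_ge0.
- by rewrite -w1 [RHS](partition_big f xpredT).
rewrite (partition_big f xpredT) //=; apply: eq_bigr => j _.
rewrite scaler_suml; apply: eq_bigr => i /eqP <-.
by rewrite /= nth_index //; apply: ps.
Qed.

Lemma conv_trans (A : set E) (s : seq E) :
  A `<=` conv [set y | y \in s] -> conv A `<=` conv [set y | y \in s].
Proof.
move=> As x [M [w [p [w0 w1 pA ->]]]].
have [W HW] := choice (fun i => conv_seqP (As _ (pA i))).
exists (size s), (fun j => \sum_i w i * W i j), (fun j : 'I_(size s) => s`_j); split.
- by move=> j; apply: sumr_ge0 => i _; rewrite mulr_ge0 //; have [] := HW i.
- rewrite exchange_big /= -[RHS]w1; apply: eq_bigr => i _.
  by rewrite -mulr_sumr; have [_ -> _] := HW i; rewrite mulr1.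
- by move=> j; apply: mem_nth.
have -> : \sum_j (\sum_i w i * W i j) *: s`_j = \sum_j \sum_i (w i * W i j) *: s`_j.
  by apply: eq_bigr => j _; rewrite scaler_suml.
rewrite exchange_big /=; apply: eq_bigr => i _.
have [_ _ ->] := HW i; rewrite scaler_sumr.
by apply: eq_bigr => j _; rewrite scalerA.
Qed.

End Conv.

Lemma image_conv (R : realType) (E F : lmodType R) (f : {linear E -> F}) (A : set E) :
  f @` conv A = conv (f @` A).
Proof.
rewrite eqEsubset; split=> x.
  move=> [_ [M [w [p [w0 w1 pA ->]]]] <-].
  exists M, w, (f \o p); split=> //; first by move=> i; exists (p i).
  by rewrite linear_sum; apply: eq_bigr => i _; rewrite linearZ.
move=> [M [w [p [w0 w1 pA ->]]]].
have /choice[q qP] : forall i, exists q, A q /\ f q = p i.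
  by move=> i; have [q Aq <-] := pA i; exists q.
exists (\sum_i w i *: q i).
  by exists M, w, q; split=> // i; have [] := qP i.
by rewrite linear_sum; apply: eq_bigr => i _; rewrite linearZ /=; have [_ ->] := qP i.
Qed.

(** The cone generated by [s], built one generator at a time to suit the induction in [farkas]. *)
Fixpoint in_cone (R : realType) (E : lmodType R) (s : seq E) (b : E) : Prop :=
  if s is a :: s' then exists2 t : R, 0 <= t & in_cone s' (b - t *: a) else b = 0.

Lemma in_coneP (R : realType) (E : lmodType R) (s : seq E) (b : E) : in_cone s b ->
  exists w : 'I_(size s) -> R, (forall i, 0 <= w i) /\ b = \sum_i w i *: s`_i.
Proof.
elim: s b => [|a s IHs] b /=; first by move=> ->; exists (fun=> 0); rewrite big_ord0.
move=> [t t0 /IHs[w [w0 wb]]].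
exists (fun i => oapp w t (unlift ord0 i)); split.
  by move=> i; case: (unlift ord0 i) => /=.
rewrite big_ord_recl unlift_none /= -[LHS](subrK (t *: a)) wb addrC.
by congr (_ + _); apply: eq_bigr => i _; rewrite liftK.
Qed.

(** This undoes the projection along [a]: the multiples of [a] subtracted from the generators add up
    to one multiple, of sign fixed by [t], which is moved to the side of [b]. *)
Lemma in_cone_shift (R : realType) (E : lmodType R) (s : seq E) (a b : E) (t : E -> R) :
  {in s, forall u, t u <= 0} -> in_cone [seq u - t u *: a | u <- s] b ->
  exists2 k, k <= 0 & in_cone s (b + k *: a).
Proof.
elim: s b => [|u s IHs] b t0 /=; first by move=> ->; exists 0; rewrite ?scale0r ?addr0.
move=> [l l0 /IHs[v vs|k k0 kb]]; first by apply: t0; rewrite inE vs orbT.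
exists (k + l * t u).
  by have := mulr_ge0_le0 l0 (t0 u (mem_head _ _)); lra.
exists l => //; congr (in_cone s _): kb.
rewrite scalerBr opprB scalerDl scalerA -!addrA; congr (b + _).
by rewrite addrC [in RHS]addrA [in RHS]addrC -addrA [- _ + _]addrC.
Qed.

(* Induction on the number of generators: if the last generator a is positive
   on a functional x0 separating b from the others, everything is projected
   along a onto the hyperplane x0 = 0. *)
Lemma farkas (R : realType) (N : nat) (s : seq 'rV[R]_N) (b : 'rV[R]_N) :
  in_cone s b \/ exists x, {in s, forall u, dotp x u <= 0} /\ 0 < dotp x b.
Proof.
have [n] := ubnP (size s); elim: n s b => // n IHn [|a s] b /= sn.
  have [->|b0] := eqVneq b 0; [by left | right; exists b; split=> //].
  rewrite lt_neqAle eq_sym andbC sumr_ge0 => [|i _]; last by rewrite -expr2 sqr_ge0.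
  apply: contra_neq b0 => /psumr_eq0P bb; apply/rowP => i; rewrite mxE.
  have /eqP : b 0 i * b 0 i = 0 by apply: bb => // j _; rewrite -expr2 sqr_ge0.
  by rewrite mulf_eq0 orbb => /eqP.
have [sb|[x0 [x0s x0b]]] := IHn s b sn.
  by left; exists 0; rewrite ?scale0r ?subr0.
have [x0a|x0a] := lerP (dotp x0 a) 0.
  by right; exists x0; split=> // u; rewrite inE => /predU1P[->|/x0s].
have [y [ys yb ya]] : exists y, [/\ {in s, forall u, dotp y u <= 0}, 0 < dotp y b & dotp y a = 1].
  exists ((dotp x0 a)^-1 *: x0); split=> [u us||].
  - by rewrite dotpZl mulr_ge0_le0 ?invr_ge0 ?(ltW x0a) // x0s.
  - by rewrite dotpZl mulr_gt0 ?invr_gt0.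
  - by rewrite dotpZl mulVf // gt_eqF.
have [] := IHn [seq u - dotp y u *: a | u <- s] (b - dotp y b *: a); first by rewrite size_map.
  move=> /(in_cone_shift ys)[k k0 kb]; left; exists (dotp y b - k).
    by rewrite subr_ge0 (le_trans k0) ?ltW.
  by rewrite scalerBl opprB addrA addrAC.
(* The new functional is [x] composed with the projection along [a], hence zero on [a]. *)
move=> [x [xs xb]]; right; exists (x - dotp x a *: y).
have E u : dotp (x - dotp x a *: y) u = dotp x (u - dotp y u *: a).
  by rewrite dotpBl dotpZl dotpBr dotpZr mulrC.
split=> [u|]; rewrite E //.
rewrite inE => /predU1P[->|us]; first by rewrite ya scale1r subrr -(scale0r 0) dotpZr mul0r.
by apply: xs; apply: map_f.
Qed.

(** Homogenisation: after a coordinate 1 is prepended to all points, lying in the hull becomes lying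
    in the cone, and [farkas] applies. The extra coordinate of the functional gives the bound. *)
Lemma conv_separation (R : realType) (N : nat) (s : seq 'rV[R]_N) (v : 'rV[R]_N) :
  ~ conv [set u | u \in s] v ->
  exists c b, {in s, forall u, dotp c u <= b} /\ b < dotp c v.
Proof.
move=> sv; pose h (u : 'rV[R]_N) : 'rV[R]_(1 + N) := row_mx 1%:M u.
have dotp_h (x : 'rV[R]_(1 + N)) u : dotp x (h u) = x 0 0 + dotp (rsubmx x) u.
  rewrite /dotp big_split_ord big_ord1 /h; congr (_ + _).
    by rewrite row_mxEl mxE eqxx mulr1; congr (x _ _); apply: val_inj.
  by apply: eq_bigr => i _; rewrite row_mxEr mxE.
have [/in_coneP[w [w0]]|[x [xs xv]]] := farkas (map h s) (h v).
  move=> hw; case: sv.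
  have hs i : (map h s)`_i = h s`_i \/ (size s <= i)%N.
    have [lt_i|] := ltnP i (size s); [left; exact: (nth_map 0) | by right].
  have {}hs (i : 'I_(size (map h s))) : (map h s)`_i = h s`_i.
    by case: (hs i) => //; rewrite -(size_map h) leqNgt ltn_ord.
  exists _, w, (fun i => s`_i); split=> //.
  - have h0 u : h u 0 (lshift N 0) = 1 by rewrite row_mxEl mxE.
    rewrite -(h0 v) hw summxE.
    by apply: eq_bigr => i _; rewrite mxE hs h0 mulr1.
  - by move=> i; apply: mem_nth; rewrite -(size_map h).
  - have hR u : rsubmx (h u) = u by rewrite row_mxKr.
    rewrite -[LHS]hR hw linear_sum /=.
    by apply: eq_bigr => i _; rewrite hs linearZ /= hR.
exists (rsubmx x), (- x 0 0); split=> [u us|].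
  by have := xs (h u) (map_f h us); rewrite dotp_h; lra.
by move: xv; rewrite dotp_h; lra.
Qed.

Definition simplex (R : realType) (N n : nat) : set 'rV[R]_N :=
  [set u | (forall i, 0 <= u 0 i) /\ \sum_i u 0 i = n%:R].

(** A real separating functional is made nonnegative by adding a constant [B] to its coordinates,
    which changes its values on the simplex by a constant, then scaled by [M] and rounded down. The
    margin [n] lets a weight be raised by 1 in one coordinate later on. *)
Lemma nat_conv_separation (R : realType) (N n : nat) (s : seq 'rV[R]_N) (v : 'rV[R]_N) :
  {in s, forall u, simplex n u} -> simplex n v -> ~ conv [set u | u \in s] v ->
  exists c : 'I_N -> nat,
    {in s, forall u, dotp (\row_i (c i)%:R) u + n%:R < dotp (\row_i (c i)%:R) v}.
Proof.
move=> ss [v0 v1] /conv_separation[c [b [cs cv]]].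
have [B B0] : exists B, forall i, 0 <= c 0 i + B.
  exists (\sum_i `|c 0 i|) => i; rewrite (bigD1 i) //=.
  have := ler_norm (- c 0 i); rewrite normrN => ci.
  have : 0 <= \sum_(j | j != i) `|c 0 j| by apply: sumr_ge0.
  by move: ci; lra.
(* Rounding lowers the value at [v] by at most [n], and a gap above [n] must remain. *)
pose M := Num.bound ((n%:R *+ 2 + 1) / (dotp c v - b)).
have MP : n%:R *+ 2 + 1 < M%:R * (dotp c v - b).
  rewrite -ltr_pdivrMr ?subr_gt0 //; apply: archi_boundP.
  by rewrite divr_ge0 ?subr_ge0 ?(ltW cv) // addr_ge0 // mulrn_wge0.
pose g i := M%:R * (c 0 i + B).
have g0 i : 0 <= g i by rewrite mulr_ge0.
have gdot (u : 'rV[R]_N) : \sum_i u 0 i = n%:R ->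
    \sum_i g i * u 0 i = M%:R * dotp c u + M%:R * B * n%:R.
  move=> u1; rewrite -u1 /dotp !mulr_sumr -big_split; apply: eq_bigr => i _.
  by rewrite /g /=; ring.
exists (fun i => Num.truncn (g i)) => u us.
have [u0 u1] := ss u us.
have le_u : dotp (\row_i (Num.truncn (g i))%:R) u <= \sum_i g i * u 0 i.
  apply: ler_sum => i _; rewrite mxE ler_wpM2r //.
  by have /andP[] := truncn_itv (g0 i).
have ge_v : \sum_i g i * v 0 i - n%:R <= dotp (\row_i (Num.truncn (g i))%:R) v.
  rewrite -v1 -sumrB; apply: ler_sum => i _; rewrite mxE.
  rewrite -[X in _ - X]mul1r -mulrBl ler_wpM2r //.
  by have /andP[_ /ltW] := truncn_itv (g0 i); rewrite -addn1 natrD; lra.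
move: le_u ge_v MP; rewrite !gdot // mulrBr.
have : M%:R * dotp c u <= M%:R * b by rewrite ler_wpM2l // cs.
by rewrite mulr2n; lra.
Qed.

(** * Newton polytopes of blow-ups *)

Lemma proj_is_linear (R : realType) (m d : nat) : linear (@proj R m d).
Proof.
move=> a x y; apply/rowP => k; rewrite !mxE mulrCA -mulrDr; congr (_ * _).
rewrite mulr_sumr -big_split; apply: eq_bigr => i _ /=.
by rewrite mulr_sumr -big_split; apply: eq_bigr => j _ /=; rewrite !mxE.
Qed.

HB.instance Definition _ (R : realType) (m d : nat) :=
  GRing.isLinear.Build R 'rV[R]_(nvars m d) 'rV[R]_m _ (@proj R m d) (@proj_is_linear R m d).

Definition exp_pt (R : realType) (m d : nat) (e : 'X_{1..nvars m d}) : 'rV[R]_m :=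
  proj (\row_i (e i)%:R).

Lemma sum_var (V : nmodType) (m d : nat) (F : 'I_(nvars m d) -> V) :
  \sum_v F v = \sum_(k < m) \sum_(i < d) \sum_(j < d) F (vidx k i j).
Proof.
rewrite (reindex (@enum_rank {: 'I_m * 'I_d * 'I_d})) /=; last first.
  exact/onW_bij/enum_rank_bij.
rewrite pair_bigA pair_bigA /=.
by apply: eq_bigr => -[[k i] j] _.
Qed.

Lemma dotp_exp_pt (R : realType) (m d : nat) (c : 'I_m -> nat) (e : 'X_{1..nvars m d}) :
  (0 < d)%N ->
  d%:R * dotp (\row_k (c k)%:R) (exp_pt R e) = (weight (c \o @var_mat m d) e)%:R.
Proof.
move=> d0; rewrite /weight natr_sum sum_var /dotp mulr_sumr; apply: eq_bigr => k _.
rewrite !mxE mulrCA mulVKf ?pnatr_eq0 -?lt0n // mulr_sumr; apply: eq_bigr => i _.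
rewrite mulr_sumr; apply: eq_bigr => j _.
by rewrite mxE /= var_mat_vidx natrM.
Qed.

Lemma seq_argmax (T : eqType) (R : realType) (f : T -> R) (s : seq T) : s != [::] ->
  exists2 x, x \in s & {in s, forall y, f y <= f x}.
Proof.
elim: s => // x s IHs _; have [->|/IHs[z zs zmax]] := eqVneq s [::].
  by exists x => [|y]; rewrite ?mem_head // inE => /eqP ->.
have [xz|/ltW zx] := lerP (f x) (f z).
  by exists z => [|y]; rewrite inE ?zs ?orbT // => /predU1P[->|/zmax].
by exists x => [|y]; rewrite ?mem_head // inE => /predU1P[->|/zmax/le_trans->].
Qed.

Section BlowupPoints.

Variables (R : realType) (K : fieldType) (m n : nat) (A : 'I_m -> 'M[K]_n).

Definition blowup_pts (d : nat) : seq 'rV[R]_m :=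
  [seq exp_pt R e | e <- msupp (\det (blowup A d))].

Lemma proj_newton (d : nat) :
  @proj R m d @` newton R (\det (blowup A d)) = conv [set x | x \in blowup_pts d].
Proof.
rewrite image_conv; congr conv; rewrite eqEsubset; split=> x.
  by move=> [_ [e eD ->] <-]; apply: map_f.
by move=> /mapP[e eD ->]; exists (\row_i (e i)%:R) => //; exists e.
Qed.

Lemma mdeg_det_blowup (d : nat) (e : 'X_{1..nvars m d}) :
  e \in msupp (\det (blowup A d)) -> mdeg e = (n * d)%N.
Proof.
suff /dhomogP : \det (blowup A d) \is (n * d).-homog by apply.
apply: rpred_sum => s _; rewrite -signr_odd mulr_sign.
have H : \prod_(i < n * d) blowup A d i (s i) \is (n * d).-homog.
  have entry (i j : 'I_(n * d)) : blowup A d i j \is 1.-homog.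
    case: (mxtens_indexP i) => i' a; case: (mxtens_indexP j) => j' b.
    rewrite -/(block_idx i' a) -/(block_idx j' b) blowupE; apply: rpred_sum => k _.
    by rewrite rpredZ // dhomogX /= mdeg1.
  have gen (r : seq 'I_(n * d)) : \prod_(i <- r) blowup A d i (s i) \is (size r).-homog.
    elim: r => [|i r IHr]; first by rewrite big_nil; exact: dhomog1.
    by rewrite big_cons -[size _]add1n; apply: dhomogM.
  by have := gen (index_enum _); rewrite -[index_enum _]enumT size_enum_ord.
by case: (odd _); rewrite ?rpredN.
Qed.

Lemma blowup_pts_simplex (d : nat) : (0 < d)%N ->
  {in blowup_pts d, forall u, simplex n u}.
Proof.
move=> d0 _ /mapP[e eD ->]; split=> [k|].
  by rewrite mxE mulr_ge0 ?invr_ge0 // sumr_ge0 // => i _; rewrite sumr_ge0 // => j _; rewrite mxE.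
apply: (@mulfI _ d%:R); first by rewrite pnatr_eq0 -lt0n.
(* For the constant weight 1 the weighted degree is the total degree, which is n d. *)
have := dotp_exp_pt R (fun=> 1%N) e d0.
rewrite /dotp /weight; under eq_bigr do rewrite mxE mul1r.
move=> ->; rewrite -natrM mulnC -(mdeg_det_blowup eD) mdegE; congr (_%:R).
by apply: eq_bigr => v _; rewrite mul1n.
Qed.

(* If v is the only maximiser of dotp c on a finite set spanning the blow-up
   points and remains so for c + e_i, then both maxima are integers by
   dvdn_wdeg_det_blowup, and their difference is the i-th coordinate of v. *)
Lemma blowup_pts_reduce (d : nat) (T : seq 'rV[R]_m) (v : 'rV[R]_m) :
  (0 < d)%N -> {subset T <= blowup_pts d} ->
  [set x | x \in blowup_pts d] `<=` conv [set x | x \in T] ->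
  v \in T -> (exists i, v 0 i \isn't a Num.int) ->
  conv [set x | x \in [seq u <- T | u != v]] v.
Proof.
move=> d0 TS ST vT [i vi]; apply: contrapT => nconv.
have simT u : u \in T -> simplex n u by move=> /TS /blowup_pts_simplex; apply.
have [||c csep] := @nat_conv_separation R m n [seq u <- T | u != v] v _ _ nconv.
- by move=> u; rewrite mem_filter => /andP[_ /simT].
- exact: simT.
(* A maximum at [v] over [T] is one over all blow-up points, as these lie in the hull of [T]. So [d]
   times its value is a weighted degree, divisible by [d]. *)
have maxv (c' : 'I_m -> nat) :
    (forall u, u \in T -> u != v -> dotp (\row_k (c' k)%:R) u <= dotp (\row_k (c' k)%:R) v) ->
    exists q : nat, dotp (\row_k (c' k)%:R) v = q%:R.
  move=> maxT; have /mapP[e eD ve] := TS _ vT.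
  have D0 : \det (blowup A d) != 0.
    by apply: contraTneq eD => ->; rewrite msupp0.
  have max_e e' : e' \in msupp (\det (blowup A d)) ->
      (weight (c' \o @var_mat m d) e' <= weight (c' \o @var_mat m d) e)%N.
    move=> e'D; rewrite -(ler_nat R) -!dotp_exp_pt // ler_wpM2l // -ve.
    apply: (dotp_le_conv (A := [set x | x \in T])); last first.
      by apply: ST; apply: map_f.
    move=> u uT; have [->//|uv] := eqVneq u v; exact: maxT.
  have wE : wdeg (c' \o @var_mat m d) (\det (blowup A d)) = weight (c' \o @var_mat m d) e.
    apply/eqP; rewrite eqn_leq; apply/andP; split.
      by apply/bigmax_leqP_seq => e' e'D _; apply: max_e.
    exact: weight_le_wdeg.
  have /dvdnP[q wq] := dvdn_wdeg_det_blowup c' d0 D0.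
  exists q; apply: (@mulfI _ d%:R); first by rewrite pnatr_eq0 -lt0n.
  by rewrite ve dotp_exp_pt // -wE wq natrM mulrC.
have dotp_i u : dotp (\row_k (c k + (k == i))%:R) u = dotp (\row_k (c k)%:R) u + u 0 i.
  rewrite /dotp [X in _ = _ + X](_ : _ = \sum_k (k == i)%:R * u 0 k); last first.
    by rewrite (bigD1 i) //= eqxx mul1r big1 ?addr0 // => k /negPf ->; rewrite mul0r.
  by rewrite -big_split; apply: eq_bigr => k _; rewrite !mxE natrD mulrDl.
have csep' u : u \in T -> u != v ->
    dotp (\row_k (c k)%:R) u + n%:R < dotp (\row_k (c k)%:R) v.
  by move=> uT uv; apply: csep; rewrite mem_filter uv.
have [q1 vq1] : exists q : nat, dotp (\row_k (c k)%:R) v = q%:R.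
  apply: maxv => u uT uv; have := csep' u uT uv; have := ler0n R n; lra.
(* Raising the weight at [i] adds at most [n] to the other points and a nonnegative amount to [v],
   so the margin keeps [v] maximal. *)
have [q2 vq2] : exists q : nat, dotp (\row_k (c k + (k == i))%:R) v = q%:R.
  apply: (maxv (fun k => c k + (k == i))%N) => u uT uv; rewrite !dotp_i.
  have := csep' u uT uv; have [v0 _] := simT v vT; have [u0 u1] := simT u uT.
  have := v0 i; have : u 0 i <= n%:R.
    by rewrite -u1 (bigD1 i) //= lerDl sumr_ge0.
  lra.
move: vi; suff -> : v 0 i = q2%:R - q1%:R by rewrite rpredB ?rpred_nat.
by rewrite -vq1 -vq2 dotp_i addrAC subrr add0r.
Qed.

(** By [blowup_pts_reduce] a non-integral point of a spanning list lies in the hull of the others.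
    Such points are discarded one at a time, all copies together, until only integral ones are
    left. *)
Lemma blowup_pts_int (d : nat) : (0 < d)%N ->
  [set x | x \in blowup_pts d] `<=`
  conv [set x | x \in [seq u : 'rV[R]_m <- blowup_pts d | [forall i, u 0 i \is a Num.int]]].
Proof.
move=> d0; pose int_pt (u : 'rV[R]_m) := [forall i, u 0 i \is a Num.int].
suff [T [TS Tint ST]] : exists T : seq 'rV[R]_m, [/\ {subset T <= blowup_pts d}, all int_pt T &
    [set x | x \in blowup_pts d] `<=` conv [set x | x \in T]].
  apply: (subset_trans ST); apply: conv_sub => x /= xT.
  by rewrite mem_filter TS // andbT; apply: (allP Tint).
have gen k (T : seq 'rV[R]_m) : (size T < k)%N -> {subset T <= blowup_pts d} ->
    [set x | x \in blowup_pts d] `<=` conv [set x | x \in T] ->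
    exists T : seq 'rV[R]_m, [/\ {subset T <= blowup_pts d}, all int_pt T &
      [set x | x \in blowup_pts d] `<=` conv [set x | x \in T]].
  elim: k T => // k IHk T szT TS ST.
  have [Tint|/allPn[v vT]] := boolP (all int_pt T); first by exists T; split.
  rewrite negb_forall => /existsP vi.
  apply: (IHk [seq u <- T | u != v]).
  - rewrite -ltnS; apply: leq_trans szT; rewrite ltnS size_filter.
    rewrite -(count_predC (fun u => u != v)) -addn1 leq_add2l -has_count.
    by apply/hasP; exists v; rewrite //= negbK.
  - by move=> u; rewrite mem_filter => /andP[_ /TS].
  - apply: (subset_trans ST); apply: conv_trans => u /= uT.
    have [->|uv] := eqVneq u v; first exact: (blowup_pts_reduce d0 TS ST vT vi).
    by apply: sub_conv; rewrite /= mem_filter uv.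
by apply: (gen _ _ (ltnSn (size (blowup_pts d)))) => //; apply: sub_conv.
Qed.

(** Otherwise some natural weight would be larger at a point of level [d] than at every point of
    level q d, against [wdeg_det_blowupM]. *)
Lemma blowup_ptsM (d q : nat) : (0 < d)%N -> (0 < q)%N ->
  [set x | x \in blowup_pts d] `<=` conv [set x | x \in blowup_pts (q * d)].
Proof.
move=> d0 q0 v vS; apply: contrapT => nconv.
have qd0 : (0 < q * d)%N by rewrite muln_gt0 q0.
have [|c csep] := nat_conv_separation (blowup_pts_simplex qd0) _ nconv.
  exact: blowup_pts_simplex vS.
have /mapP[e eD ve] := vS.
have D0 : \det (blowup A d) != 0 by apply: contraTneq eD => ->; rewrite msupp0.
have [D'0] := wdeg_det_blowupM q c D0.
apply/negP; rewrite -ltnNge.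
have [e' e'D ->] := wdeg_witness (c \o @var_mat m (q * d)) D'0.
have le_e : (weight (c \o @var_mat m d) e <= wdeg (c \o @var_mat m d) (\det (blowup A d)))%N.
  exact: weight_le_wdeg.
apply: leq_trans (leq_mul le_e (leqnn q)).
rewrite -(ltr_nat R) natrM -!dotp_exp_pt // -ve [X in _ < X]mulrAC [d%:R * q%:R]mulrC -natrM.
rewrite ltr_pM2l ?ltr0n //.
by have := csep _ (map_f (@exp_pt R m (q * d)) e'D); have := ler0n R n; lra.
Qed.

End BlowupPoints.

Theorem theorem4p4 (R : realType) (K : fieldType) (m n : nat)
    (A : 'I_m -> 'M[K]_n) :
  integral_polytope (nc_newton R A) /\
  nc_newton R A `<=`
    [set u : 'rV[R]_m | (forall i, 0 <= u 0 i) /\ \sum_(i < m) u 0 i = n%:R].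
Proof.
have ncE : nc_newton R A = \bigcup_(d in [set d : nat | (0 < d)%N])
    conv [set x | x \in blowup_pts R A d].
  by apply: eq_bigcupr => d _; rewrite proj_newton.
(* A finite list holding every integral point of the simplex, since the coordinates there lie
   between 0 and [n]. The list [s] keeps those that occur at some level [d]. *)
pose lattice : seq 'rV[R]_m := [seq \row_i (f i : nat)%:R | f : {ffun 'I_m -> 'I_n.+1}].
pose s := [seq z <- lattice | `[< exists2 d, (0 < d)%N & z \in blowup_pts R A d >]].
have ncs : nc_newton R A = conv [set x | x \in s].
  rewrite ncE eqEsubset; split=> [x [d /= d0] | x].
    apply: conv_trans; apply: (subset_trans (blowup_pts_int d0)); apply: conv_sub => u /=.
    rewrite !mem_filter => /andP[/forallP u_int uS]; apply/andP; split.
      by apply/asboolP; exists d.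
    have [u0 u1] := blowup_pts_simplex d0 uS.
    have /choice[f uf] : forall i, exists k : 'I_n.+1, u 0 i = k%:R.
      move=> i; have /natrP[k uk] : u 0 i \is a Num.nat by rewrite natrEint u_int u0.
      have kn : (k < n.+1)%N.
        by rewrite ltnS -(ler_nat R) -uk -u1 (bigD1 i) //= lerDl sumr_ge0.
      by exists (Ordinal kn).
    apply/fintype.imageP; exists [ffun i => f i] => //.
    by apply/rowP => i; rewrite mxE ffunE uf.
  move=> [M [w [p [w0 w1 ps ->]]]].
  have /choice[D DP] : forall i, exists d, (0 < d)%N /\ p i \in blowup_pts R A d.
    by move=> i; have := ps i; rewrite /= mem_filter => /andP[/asboolP[d d0 pd] _]; exists d.
  (* A convex combination uses finitely many points; the product of their levels is a common
     multiple, so [blowup_ptsM] brings them all to one level. *)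
  exists (\prod_i D i)%N; first by rewrite /= prodn_gt0 // => i; have [] := DP i.
  apply: (conv_trans (A := [set p i | i in setT])).
    move=> _ [i _ <-]; have [Di pi] := DP i.
    rewrite (bigD1 i) //= mulnC; apply: blowup_ptsM => //.
    by rewrite prodn_cond_gt0 // => j _; have [] := DP j.
  by exists M, w, p; split=> // i; exists i.
split; last first.
  rewrite ncE => x [d /= d0] [M [w [p [w0 w1 pS ->]]]].
  have psim i := blowup_pts_simplex d0 (pS i).
  split=> [k|].
    rewrite summxE sumr_ge0 // => i _; rewrite mxE mulr_ge0 //; have [H _] := psim i; exact: H.
  under eq_bigr do rewrite summxE; rewrite exchange_big /=.
  under eq_bigr => i _.
    under eq_bigr do rewrite mxE; rewrite -mulr_sumr; have [_ ->] := psim i; over.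
  by rewrite -mulr_suml w1 mul1r.
split; first by exists s.
move=> v [c]; rewrite ncs => Fv.
have [vP vmax] : [set x | conv [set x0 | x0 \in s] x /\
    (forall y, conv [set x0 | x0 \in s] y -> dotp c y <= dotp c x)] v by rewrite -Fv.
(* The maximum of [c] over the hull is attained at a point of [s], so the one-point face [[set v]]
   consists of a lattice point. The list [s] is nonempty because the weights of a convex combination
   sum to 1. *)
have [x0 x0s x0max] : exists2 x0, x0 \in s & {in s, forall y, dotp c y <= dotp c x0}.
  apply: seq_argmax; apply/eqP => s0; case: vP => [[|M] [w [p [_ w1 ps _]]]].
    by move/eqP: w1; rewrite big_ord0 eq_sym oner_eq0.
  by have := ps ord0; rewrite s0.
have : [set v] x0.
  rewrite Fv; split; first exact: sub_conv.
  by move=> y; apply: dotp_le_conv.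
move=> /= vx i; rewrite -vx.
move: x0s; rewrite mem_filter => /andP[_ /fintype.imageP[f _ ->]].
by rewrite mxE rpred_nat.
Qed.
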